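(* Let $f$ be as in the context. The $\mathrm{SL}(2,\mathbb{R})$-action $P\cdot(J,A)=(PJP^{-1},PA(P^{-1}\cdot)P^{-1})$ on $D^3(\mathcal{J}(\mathbb{R}^2))\setminus\{\text{zero section}\}\cong\mathcal{B}_0(T^2)$ is Hamiltonian with respect to $\boldsymbol{\omega}$, with moment map $\mu:\mathcal{B}_0(T^2)\to\mathfrak{sl}(2,\mathbb{R})^*$ given by $$\mu_{(J,A)}(X)=\big(1-f(\|A\|_0^2)\big)\,\mathrm{tr}(JX),\qquad X\in\mathfrak{sl}(2,\mathbb{R}).$$ That is: $\mu_{P\cdot(J,A)}=\mu_{(J,A)}\circ\mathrm{Ad}(P^{-1})$ for all $P\in\mathrm{SL}(2,\mathbb{R})$, and for every $X\in\mathfrak{sl}(2,\mathbb{R})$ the function $\mu^X(J,A)=\mu_{(J,A)}(X)$ satisfies $d\mu^X=\boldsymbol{\omega}(V_X,\cdot)$, where $V_X(p)=\frac{d}{dt}\big|_{t=0}\exp(tX)\cdot p$.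
   Context: $f:[0,+\infty)\to(-\infty,0]$ is smooth with $f'(t)<0$ for all $t\ge0$ and $\lim_{t\to+\infty}f(t)=-\infty$. $\mathfrak{sl}(2,\mathbb{R})$ is the space of traceless $2\times2$ real matrices. Let $\rho=dx_0\wedge dy_0$ on $\mathbb{R}^2$. $\mathcal{J}(\mathbb{R}^2)=\{J\in \mathrm{End}(\mathbb{R}^2): J^2=-\mathbb{1},\ \rho(v,Jv)>0 \text{ for some } v\neq 0\}$; $g_J(\cdot,\cdot):=\rho(\cdot,J\cdot)$. $T_J\mathcal{J}(\mathbb{R}^2)=\{\dot J: J\dot J+\dot JJ=0\}$, with $\langle \dot J,\dot J'\rangle_J=\tfrac12\mathrm{tr}(\dot J\dot J')$. $D^3(\mathcal{J}(\mathbb{R}^2))=\{(J,C)\in\mathcal{J}(\mathbb{R}^2)\times S_3(\mathbb{R}^2): C(J\cdot,J\cdot,J\cdot)=-C(J\cdot,\cdot,\cdot)\}$, $S_3(\mathbb{R}^2)$ the totally symmetric trilinear forms. Pick form $A=g_J^{-1}C$, i.e. $g_J(A(X)Y,Z)=C(X,Y,Z)$; identify $(J,C)$ with $(J,A)$; $A(P^{-1}\cdot)$ denotes pull-back of the form part. With a $g_J$-orthonormal basis $e_1,e_2$, $Je_1=e_2$, dual basis $e_i^*$, write $A=A_1e_1^*+A_2e_2^*$; $\langle A,B\rangle_J=\mathrm{tr}(A_1B_1+A_2B_2)$, $\|A\|_0^2=\tfrac14\langle A,A\rangle_J$, $A_{\mathrm{tr}}=\tfrac12\mathrm{tr}(A_1)\mathbb{1}e_1^*+\tfrac12\mathrm{tr}(A_2)\mathbb{1}e_2^*$,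 $A_0=A-A_{\mathrm{tr}}$; $(AJ)(X)=A(X)J$. Tangent vectors: $(\dot J,\dot A)$ with $\dot A=g_J^{-1}\dot C$. $\mathbf{g}_{(J,A)}((\dot J,\dot A),(\dot J',\dot A'))=(1-f(\|A\|_0^2))\langle\dot J,\dot J'\rangle_J+\tfrac{f'(\|A\|_0^2)}{3}\langle\dot A_0,\dot A'_0\rangle_J-\tfrac{f'(\|A\|_0^2)}{6}\langle\dot A_{\mathrm{tr}},\dot A'_{\mathrm{tr}}\rangle_J$; $\mathbf{I}_{(J,A)}(\dot J,\dot A)=(-J\dot J,-\dot AJ-A\dot J)$; $\boldsymbol{\omega}(\cdot,\cdot)=\mathbf{g}(\cdot,\mathbf{I}\cdot)$. $\mathcal{B}_0(T^2)$, the deformation space of properly convex $\mathbb{RP}^2$-structures on the torus, is identified with the complement of the zero section of $D^3(\mathcal{J}(\mathbb{R}^2))$. *)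

(* Defs.v *)
From HB Require Import structures.
From mathcomp Require Import all_boot all_order all_algebra.
From mathcomp Require Import all_classical all_reals all_analysis.
Set Implicit Arguments. Unset Strict Implicit. Unset Printing Implicit Defensive.
Import Order.TTheory GRing.Theory Num.Theory.
Import numFieldNormedType.Exports.
Local Open Scope ring_scope.

Section Defs.
Variable R : realType.

Definition sb (i : 'I_2) : 'cV[R]_2 := delta_mx i 0.

Definition rho (u v : 'cV[R]_2) : R := u 0 0 * v 1 0 - u 1 0 * v 0 0.

Definition isCpx (J : 'M[R]_2) : Prop :=
  J *m J = - 1%:M /\ exists v : 'cV[R]_2, v != 0 /\ 0 < rho v (J *m v).

Definition gJ (J : 'M[R]_2) (u v : 'cV[R]_2) : R := rho u (J *m v).
Definition gmx (J : 'M[R]_2) : 'M[R]_2 := \matrix_(i, j) gJ J (sb i) (sb j).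

(* trilinear forms on R^2, given by their coefficients in the standard basis *)
Definition tri := 'I_2 -> 'I_2 -> 'I_2 -> R.
Definition tri_app (C : tri) (X Y Z : 'cV[R]_2) : R :=
  \sum_(i < 2) \sum_(j < 2) \sum_(k < 2) C i j k * X i 0 * Y j 0 * Z k 0.

(* End(R^2)-valued 1-forms, given by their values on the standard basis *)
Definition form1 := 'I_2 -> 'M[R]_2.
Definition fapp (A : form1) (v : 'cV[R]_2) : 'M[R]_2 := v 0 0 *: A 0 + v 1 0 *: A 1.

(* A = g_J^{-1} C, i.e. g_J(A(X)Y, Z) = C(X,Y,Z) *)
Definition raise (J : 'M[R]_2) (C : tri) : form1 :=
  fun i => ((\matrix_(j, k) C i j k) *m invmx (gmx J))^T.
Definition lower (J : 'M[R]_2) (A : form1) : tri :=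
  fun i j k => gJ J (A i *m sb j) (sb k).

Definition bpt := ('M[R]_2 * tri)%type.
Definition inB0 (p : bpt) : Prop :=
  isCpx p.1 /\
  (forall i j k, p.2 i j k = p.2 j i k /\ p.2 i j k = p.2 i k j) /\
  (forall X Y Z : 'cV[R]_2,
     tri_app p.2 (p.1 *m X) (p.1 *m Y) (p.1 *m Z) = - tri_app p.2 (p.1 *m X) Y Z) /\
  (exists i j k, p.2 i j k != 0).

(* a g_J-orthonormal basis e1, e2 = J e1 *)
Definition onb1 (J : 'M[R]_2) : 'cV[R]_2 := (Num.sqrt (gJ J (sb 0) (sb 0)))^-1 *: sb 0.
Definition onb2 (J : 'M[R]_2) : 'cV[R]_2 := J *m onb1 J.

Definition ipA (J : 'M[R]_2) (A B : form1) : R :=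
  \tr (fapp A (onb1 J) *m fapp B (onb1 J)) + \tr (fapp A (onb2 J) *m fapp B (onb2 J)).
Definition norm0sq (J : 'M[R]_2) (A : form1) : R := ipA J A A / 4.
Definition Atr (A : form1) : form1 := fun i => (\tr (A i) / 2) *: 1%:M.
Definition A0 (A : form1) : form1 := fun i => A i - Atr A i.
Definition ipJ (Jd Jd' : 'M[R]_2) : R := \tr (Jd *m Jd') / 2.

Definition tvec := ('M[R]_2 * form1)%type.

Definition gmet (f : R -> R) (J : 'M[R]_2) (A : form1) (u v : tvec) : R :=
  (1 - f (norm0sq J A)) * ipJ u.1 v.1
  + derive1 f (norm0sq J A) / 3 * ipA J (A0 u.2) (A0 v.2)
  - derive1 f (norm0sq J A) / 6 * ipA J (Atr u.2) (Atr v.2).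

Definition Iop (J : 'M[R]_2) (A : form1) (u : tvec) : tvec :=
  (- (J *m u.1), fun i => - (u.2 i *m J) - A i *m u.1).

Definition omega (f : R -> R) (p : bpt) (u v : tvec) : R :=
  gmet f p.1 (raise p.1 p.2) u (Iop p.1 (raise p.1 p.2) v).

Definition mu (f : R -> R) (p : bpt) (X : 'M[R]_2) : R :=
  (1 - f (norm0sq p.1 (raise p.1 p.2))) * \tr (p.1 *m X).

(* SL(2,R)-action P.(J,A) = (P J P^-1, P A(P^-1 .) P^-1), transported to (J,C) *)
Definition act (P : 'M[R]_2) (p : bpt) : bpt :=
  let J' := P *m p.1 *m invmx P in
  let A := raise p.1 p.2 in
  let A' : form1 := fun i => P *m fapp A (invmx P *m sb i) *m invmx P in
  (J', lower J' A').

Definition tangent (gamma : R -> bpt) : tvec :=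
  (\matrix_(i, j) derive1 (fun t => (gamma t).1 i j) 0,
   raise (gamma 0).1 (fun i j k => derive1 (fun t => (gamma t).2 i j k) 0)).

Definition curve_derivable (gamma : R -> bpt) : Prop :=
  (forall i j, derivable (fun t => (gamma t).1 i j) 0 1) /\
  (forall i j k, derivable (fun t => (gamma t).2 i j k) 0 1).

Definition expm (X : 'M[R]_2) : 'M[R]_2 :=
  \matrix_(i, j) (limn (series (fun k : nat => (X ^+ k) i j / (k`!)%:R))).

Definition VX (X : 'M[R]_2) (p : bpt) : tvec :=
  tangent (fun t => act (expm (t *: X)) p).

Definition smooth (f : R -> R) : Prop :=
  forall (n : nat) (x : R), derivable (iter n (fun g => derive1 g) f) x 1.

End Defs.

(* Main.v *)
Require Import Defs.
From HB Require Import structures.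
From mathcomp Require Import all_boot all_order all_algebra.
From mathcomp Require Import all_classical all_reals all_analysis.
From mathcomp Require Import ring lra.
Set Implicit Arguments.
Unset Strict Implicit.
Unset Printing Implicit Defensive.
Import Order.TTheory GRing.Theory Num.Theory.
Import numFieldNormedType.Exports.
Local Open Scope classical_set_scope.
Local Open Scope ring_scope.

(* Write J = [[a, b], [c, -a]] with a^2 + bc = -1 and c > 0. The condition on C
   says that C is g_J-trace-free, so (a, c, C_000, C_001) are global coordinates
   and every other entry of (J, C), and of a tangent vector, is a rational
   function of coordinates with denominator a power of c. In them
   |A|_0^2 = (C_000^2 + (a C_000 + c C_001)^2) / c^3.
   Equivariance holds because the action on C is pull-back by P^-1, which
   preserves |A|_0. For the Hamiltonian equation, exp(tX) has derivative X at 0,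
   so V_X = ([X, J], - g_J^-1 (L_X C)), and the equation splits into the identities
   <[X, J], -J J'>_J = tr(J' X) for the (1 - f)-term and
   <V_0, W_0>_J / 3 - <V_tr, W_tr>_J / 6 = - d(|A|_0^2) tr(J X) for the f'-term,
   both of which are identities of rational functions in the coordinates. *)

(** * Sums and case analysis over two indices *)

Lemma sum_ord2 (V : nmodType) (F : 'I_2 -> V) : \sum_(i < 2) F i = F 0 + F 1.
Proof.
rewrite big_ord_recl big_ord_recl big_ord0 addr0; congr (F _ + F _); exact: val_inj.
Qed.

Lemma ord2P (P : 'I_2 -> Prop) : P 0 -> P 1 -> forall i, P i.
Proof.
move=> P0 P1 [[|[|//]] lti].
  by rewrite (_ : Ordinal lti = 0) //; exact: val_inj.
by rewrite (_ : Ordinal lti = 1) //; exact: val_inj.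
Qed.

(** * Coordinates for J, for the metric g_J and for the pairing of forms *)

Section Coordinates.
Variable R : realType.
Implicit Types (J P Q X : 'M[R]_2) (A B : form1 R) (C : tri R).

Lemma mulmx2E (m n : nat) (A : 'M[R]_(m, 2)) (B : 'M[R]_(2, n)) i j :
  (A *m B) i j = A i 0 * B 0 j + A i 1 * B 1 j.
Proof. by rewrite mxE sum_ord2. Qed.

Lemma mxtrace2E X : \tr X = X 0 0 + X 1 1.
Proof. by rewrite /mxtrace sum_ord2. Qed.

Lemma eq_mx2 P Q : P 0 0 = Q 0 0 -> P 0 1 = Q 0 1 -> P 1 0 = Q 1 0 ->
  P 1 1 = Q 1 1 -> P = Q.
Proof. by move=> *; apply/matrixP; elim/ord2P; elim/ord2P. Qed.

Lemma invmx_eq (n : nat) (P Q : 'M[R]_n) : P *m Q = 1%:M -> invmx P = Q.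
Proof.
by move=> PQ; have [uP _] := mulmx1_unit PQ; rewrite -[RHS](mulKmx uP) PQ mulmx1.
Qed.

Lemma mulmx_sb (m : nat) (A : 'M[R]_(m, 2)) i j : (A *m sb R j) i 0 = A i j.
Proof. by rewrite -colE mxE. Qed.

(** The off-diagonal equations are multiples of a + d, so a non-zero trace would force b = 0 and a^2
    = -1. Once d = - a, completing the square turns c times the positive value of the quadratic form
    into (c x - a y)^2 + y^2, which fixes the sign of c. *)
Lemma cpx_entries (a b c d x y : R) :
  a * a + b * c = -1 -> c * a + d * c = 0 -> a * b + b * d = 0 ->
  0 < x * (c * x + d * y) - y * (a * x + b * y) ->
  d = - a /\ 0 < c.
Proof.
move=> e00 e10 e01 q_gt0.
have a2 := sqr_ge0 a.
have dE : d = - a.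
  have [//|ne] := eqVneq d (- a).
  have nz : a + d != 0 by rewrite addrC addr_eq0.
  have b0 : b = 0 by apply/(mulIf nz); rewrite mul0r -e01; ring.
  by rewrite b0 mul0r addr0 in e00; move: a2; rewrite expr2 e00; lra.
split=> //; rewrite dE in q_gt0.
have c_neq0 : c != 0.
  by apply: contraTneq a2 => c0; rewrite expr2 -ltNge; move: e00; rewrite c0; lra.
rewrite lt_neqAle eq_sym c_neq0 /= -(pmulr_lge0 _ q_gt0).
have -> : c * (x * (c * x + - a * y) - y * (a * x + b * y)) =
  (c * x - a * y) ^+ 2 + y ^+ 2 * - (a * a + b * c) by ring.
by rewrite e00 opprK mulr1 addr_ge0 ?sqr_ge0.
Qed.

Lemma isCpx_coord J : isCpx J ->
  [/\ J 1 1 = - J 0 0, J 0 1 * J 1 0 = - 1 - J 0 0 * J 0 0 & 0 < J 1 0].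
Proof.
case=> JJ [v [_]]; rewrite /rho !mulmx2E.
have E i j : (J *m J) i j = - (i == j)%:R by rewrite JJ !mxE.
have := E 0 0; have := E 0 1; have := E 1 0.
rewrite !mulmx2E /= oppr0 => e10 e01 e00 v_gt0.
have [-> c_gt0] := cpx_entries e00 e10 e01 v_gt0.
by split=> //; rewrite -e00; ring.
Qed.

(** The Gram matrix [[c, -a], [-a, -b]] has determinant - a^2 - bc = 1, so its inverse is its
    adjugate, without denominators. *)
Lemma invmx_gmx J : isCpx J -> invmx (gmx J) =
  \matrix_(i, j) if i == 0 then (if j == 0 then - J 0 1 else J 0 0)
                  else (if j == 0 then J 0 0 else J 1 0).
Proof.
case/isCpx_coord => trJ detJ _; apply: invmx_eq.
apply: eq_mx2; rewrite mulmx2E !mxE /gJ /rho !mulmx_sb !mxE /= ?mulr1n ?mulr0n trJ; ring: detJ.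
Qed.

Lemma raiseE J C i k j : isCpx J -> raise J C i k j =
  if k == 0 then - J 0 1 * C i j 0 + J 0 0 * C i j 1
  else J 0 0 * C i j 0 + J 1 0 * C i j 1.
Proof.
move=> cJ; rewrite /raise invmx_gmx // mxE mulmx2E !mxE /=.
by elim/ord2P: k => /=; ring.
Qed.

Lemma lower_raise J C : isCpx J -> lower J (raise J C) = C.
Proof.
move=> cJ; have [trJ detJ _] := isCpx_coord cJ.
apply/funext => i; apply/funext => j; apply/funext => k.
rewrite /lower /gJ /rho !mulmx_sb !raiseE //=.
by elim/ord2P: k; rewrite /= ?trJ; ring: detJ.
Qed.

Lemma raise_lower J A : isCpx J -> raise J (lower J A) = A.
Proof.
move=> cJ; have [trJ detJ _] := isCpx_coord cJ.
apply/funext => i; apply/matrixP => k j.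
rewrite raiseE // /lower /gJ /rho !mulmx_sb.
by elim/ord2P: k; rewrite /= ?trJ; ring: detJ.
Qed.

(** This is contraction with the inverse Gram matrix of [invmx_gmx]; it removes the square root
    hidden in [onb1]. *)
Lemma ipAE J A B : isCpx J -> ipA J A B =
  - J 0 1 * \tr (A 0 *m B 0) + J 0 0 * (\tr (A 0 *m B 1) + \tr (A 1 *m B 0))
  + J 1 0 * \tr (A 1 *m B 1).
Proof.
move=> cJ; have [trJ detJ c_gt0] := isCpx_coord cJ.
have E : gJ J (sb R 0) (sb R 0) = J 1 0.
  by rewrite /gJ /rho !mulmx_sb !mxE /=; ring.
have cN0 : J 1 0 != 0 by rewrite gt_eqF.
(* The basis is s e_0 and s (a e_0 + c e_1), so the bilinear pairing involves [s] only through s^2 =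
   1 / c. *)
pose s := (Num.sqrt (J 1 0))^-1.
have ss : s * s = (J 1 0)^-1 by rewrite -invfM -expr2 sqr_sqrtr // ltW.
have e10 : onb1 J 0 0 = s by rewrite /onb1 E !mxE /= mulr1.
have e11 : onb1 J 1 0 = 0 by rewrite /onb1 E !mxE /= mulr0.
rewrite /ipA /fapp /onb2 !mulmx2E e10 e11 !mxtrace2E !mulmx2E !mxE.
have b_eq : J 0 1 = - (1 + J 0 0 ^+ 2) / J 1 0.
  by apply: (mulIf cN0); rewrite divfK //; lra.
rewrite b_eq.
transitivity (s * s * ((1 + J 0 0 ^+ 2) * \tr (A 0 *m B 0)
  + J 0 0 * J 1 0 * (\tr (A 0 *m B 1) + \tr (A 1 *m B 0))
  + J 1 0 ^+ 2 * \tr (A 1 *m B 1))); last first.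
  by rewrite ss !mxtrace2E !mulmx2E; field.
by rewrite !mxtrace2E !mulmx2E; ring.
Qed.

End Coordinates.

(** * The action on cubic forms, equivariance, and coordinates on the deformation space *)

Section Action.
Variable R : realType.
Implicit Types (J P Q X : 'M[R]_2) (A B : form1 R) (C : tri R) (p : bpt R).

Lemma det_mx2 P : \det P = P 0 0 * P 1 1 - P 0 1 * P 1 0.
Proof.
rewrite (expand_det_row _ 0) sum_ord2 /cofactor !det_mx11 !mxE /=.
have -> : lift (0 : 'I_2) (0 : 'I_1) = 1 by exact: val_inj.
have -> : lift (1 : 'I_2) (0 : 'I_1) = 0 by exact: val_inj.
by rewrite expr0 expr1 mul1r mulN1r mulrN.
Qed.

Lemma rho_mulmx P u v : rho (P *m u) (P *m v) = \det P * rho u v.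
Proof. by rewrite /rho !mulmx2E det_mx2; ring. Qed.

Lemma invmx2E P : \det P != 0 ->
  [/\ invmx P 0 0 = P 1 1 / \det P, invmx P 0 1 = - P 0 1 / \det P,
      invmx P 1 0 = - P 1 0 / \det P & invmx P 1 1 = P 0 0 / \det P].
Proof.
move=> dP; rewrite (@invmx_eq _ _ _ (\matrix_(i, j) if i == 0
  then (if j == 0 then P 1 1 / \det P else - P 0 1 / \det P)
  else (if j == 0 then - P 1 0 / \det P else P 0 0 / \det P))); last first.
  by apply: eq_mx2; rewrite mulmx2E !mxE /= ?mulr1n ?mulr0n det_mx2; field;
    rewrite -det_mx2.
by rewrite !mxE.
Qed.

Lemma tri_app_lower J A (X Y Z : 'cV[R]_2) :
  tri_app (lower J A) X Y Z = gJ J (fapp A X *m Y) Z.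
Proof.
rewrite /tri_app !sum_ord2 /lower /gJ /rho !mulmx_sb /fapp !mulmx2E !mxE.
by ring.
Qed.

Lemma tri_app_sb C i j k : tri_app C (sb R i) (sb R j) (sb R k) = C i j k.
Proof.
rewrite /tri_app !sum_ord2 !mxE /=.
by elim/ord2P: i; elim/ord2P: j; elim/ord2P: k; rewrite /=; ring.
Qed.

(** P scales [rho] by its determinant, so the transported form is the pull-back of C by P^-1 up to
    that factor. Keeping the factor lets the formula apply directly to exp(tX). *)
Lemma act_tri P p i j k : isCpx p.1 -> (act P p).2 i j k =
  \det P * tri_app p.2 (invmx P *m sb R i) (invmx P *m sb R j) (invmx P *m sb R k).
Proof.
move=> cJ; rewrite -[p.2 in RHS](lower_raise _ cJ) tri_app_lower.
by rewrite /act /= /lower /gJ -!mulmxA rho_mulmx.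
Qed.

Lemma tri_app_mul C (X Y Z : 'cV[R]_2) : tri_app C X Y Z =
  \sum_(i < 2) X i 0 * (\sum_(j < 2) Y j 0 * (\sum_(k < 2) Z k 0 * C i j k)).
Proof. by rewrite /tri_app !sum_ord2; ring. Qed.

Lemma isCpx_conj P J : \det P = 1 -> isCpx J -> isCpx (P *m J *m invmx P).
Proof.
move=> dP [JJ [v [v_neq0 v_gt0]]].
have uP : P \in unitmx by rewrite unitmxE dP unitr1.
split.
  rewrite !mulmxA mulmxKV // -(mulmxA P) JJ mulmxN mulmx1 mulNmx mulmxV //.
exists (P *m v); split; last by rewrite -!mulmxA mulKmx // rho_mulmx dP mul1r.
by apply: contraNneq v_neq0 => Pv0; rewrite -(mulKmx uP v) Pv0 mulmx0.
Qed.

(** Conjugation by P drops out of the traces, and the substitution of P^-1 in the form argument is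
    compensated by the change of the inverse Gram matrix in [ipAE], a polynomial identity modulo det
    P = 1. *)
Lemma norm0sq_act P p : \det P = 1 -> isCpx p.1 ->
  norm0sq (act P p).1 (raise (act P p).1 (act P p).2) =
  norm0sq p.1 (raise p.1 p.2).
Proof.
move=> dP cJ; have cJ' := isCpx_conj dP cJ.
have uP : P \in unitmx by rewrite unitmxE dP unitr1.
rewrite /norm0sq /act /= raise_lower // !ipAE //; congr (_ / _).
set A := raise _ _; set J := p.1 in cJ *.
have trA u v : \tr (P *m fapp A u *m invmx P *m (P *m fapp A v *m invmx P)) =
    u 0 0 * v 0 0 * \tr (A 0 *m A 0) + u 0 0 * v 1 0 * \tr (A 0 *m A 1) +
    u 1 0 * v 0 0 * \tr (A 1 *m A 0) + u 1 0 * v 1 0 * \tr (A 1 *m A 1).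
  rewrite !mulmxA mulmxKV // mxtrace_mulC !mulmxA mulVmx // mul1mx /fapp.
  rewrite !mulmxDl !mulmxDr -!scalemxAl -!scalemxAr !mxtraceD !mxtraceZ; ring.
have [] := @invmx2E P; first by rewrite dP oner_neq0.
rewrite dP !divr1 => Q00 Q01 Q10 Q11.
have [trJ _ _] := isCpx_coord cJ.
rewrite !trA !mulmx_sb !mulmx2E !Q00 !Q01 !Q10 !Q11 trJ.
have d : P 0 0 * P 1 1 = 1 + P 0 1 * P 1 0 by rewrite -dP det_mx2 subrK.
ring: d.
Qed.

Lemma mu_act f P p X : \det P = 1 -> isCpx p.1 ->
  mu f (act P p) X = mu f p (invmx P *m X *m P).
Proof.
move=> dP cJ; rewrite /mu norm0sq_act //; congr (_ * _).
by rewrite /= -!mulmxA mxtrace_mulC -!mulmxA.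
Qed.

(* Contracting [C (J X) (J Y) (J Z) = - C (J X) Y Z] against e_0, e_0 says that
   C is trace-free with respect to [gJ J]. *)
Lemma inB0_trace_free p i : inB0 p ->
  p.1 1 0 * p.2 i 1 1 = p.1 0 1 * p.2 i 0 0 - 2 * p.1 0 0 * p.2 i 0 1.
Proof.
case=> cJ [symC [CJ _]]; have [trJ detJ c_gt0] := isCpx_coord cJ.
(* Since J^2 = -1, the vector X = - J e_i satisfies J X = e_i. *)
have := CJ (- (p.1 *m sb R i)) (sb R 0) (sb R 0).
rewrite mulmxN mulmxA cJ.1 mulNmx mul1mx opprK tri_app_sb.
rewrite !tri_app_mul !sum_ord2 !mulmx_sb !mxE /= => h.
apply: (mulfI (lt0r_neq0 c_gt0)).
have {h} h : p.1 0 0 * (p.1 0 0 * p.2 i 0 0 + p.1 1 0 * p.2 i 0 1) +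
    p.1 1 0 * (p.1 0 0 * p.2 i 0 1 + p.1 1 0 * p.2 i 1 1) = - p.2 i 0 0.
  move: h.
  by elim/ord2P: i; rewrite /= !(mul1r, mul0r, add0r, addr0) => <-; rewrite (symC _ 1 0).2.
have {}detJ := congr1 ( *%R (p.2 i 0 0)) detJ.
lra.
Qed.

Lemma inB0_sym p : inB0 p ->
  [/\ p.2 0 1 0 = p.2 0 0 1, p.2 1 0 0 = p.2 0 0 1, p.2 1 0 1 = p.2 0 1 1 &
      p.2 1 1 0 = p.2 0 1 1].
Proof.
case=> _ [symC _].
have e1 := (symC 0 0 1).2; have e2 := (symC 0 1 0).1.
by have e3 := (symC 0 1 1).1; have e4 := (symC 1 0 1).2; split; congruence.
Qed.

(** Used as rewrite rules from the last to the first, these leave only a, c, C_000 and C_001. *)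
Lemma inB0_coord p : inB0 p ->
  [/\ p.1 0 1 = (- 1 - p.1 0 0 * p.1 0 0) / p.1 1 0,
      p.2 0 1 1 = (p.1 0 1 * p.2 0 0 0 - 2 * p.1 0 0 * p.2 0 0 1) / p.1 1 0 &
      p.2 1 1 1 = (p.1 0 1 * p.2 0 0 1 - 2 * p.1 0 0 * p.2 0 1 1) / p.1 1 0].
Proof.
move=> pB; have [_ detJ c_gt0] := isCpx_coord pB.1.
have cN0 := lt0r_neq0 c_gt0; have [_ s2 s3 _] := inB0_sym pB.
have t0 := inB0_trace_free 0 pB; have t1 := inB0_trace_free 1 pB.
rewrite s2 s3 in t1; split.
- by apply: (mulIf cN0); rewrite divfK.
- by apply: (mulfI cN0); rewrite t0 [RHS]mulrC divfK.
- by apply: (mulfI cN0); rewrite t1 [RHS]mulrC divfK.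
Qed.

(** In the orthonormal basis e1 = c^(-1/2) e_0, e2 = J e1, a trace-free cubic form has two
    independent components, C(e1, e1, e1) = c^(-3/2) C_000 and C(e1, e1, e2) = c^(-3/2) (a C_000 + c
    C_001); the norm is the sum of their squares. *)
Lemma norm0sqE p : inB0 p -> norm0sq p.1 (raise p.1 p.2) =
  (p.2 0 0 0 ^+ 2 + (p.1 0 0 * p.2 0 0 0 + p.1 1 0 * p.2 0 0 1) ^+ 2) / p.1 1 0 ^+ 3.
Proof.
move=> pB; have [trJ _ /lt0r_neq0 cN0] := isCpx_coord pB.1.
have [s1 s2 s3 s4] := inB0_sym pB; have [bE e0 e1] := inB0_coord pB.
have cJ := pB.1; rewrite /norm0sq ipAE // !mxtrace2E !mulmx2E !raiseE //=.
by rewrite s1 s2 s3 s4 e1 e0 bE; field.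
Qed.
End Action.

(** * The derivative of exp(tX) at t = 0 *)

Section Exponential.
Variable R : realType.
Implicit Types (X : 'M[R]_2).

(** The sum of all absolute entries bounds each absolute row sum, so one more factor X enlarges the
    bound on the entries by at most that sum. *)
Lemma normr_expmx_le X k i j :
  `|(X ^+ k) i j| <= (\sum_(i < 2) \sum_(j < 2) `|X i j|) ^+ k.
Proof.
set m := \sum_(i < 2) _.
have row_le l : `|X l 0| + `|X l 1| <= m.
  rewrite /m !sum_ord2; elim/ord2P: l; rewrite ?lerDl ?lerDr addr_ge0 //.
elim: k i => [|k IHk] i.
  by rewrite !expr0 mxE; case: eqP => _; rewrite ?normr1 // normr0 ler01.
rewrite !exprS -[X * _]/(X *m _) mulmx2E (le_trans (ler_normD _ _)) // !normrM.
rewrite (@le_trans _ _ ((`|X i 0| + `|X i 1|) * m ^+ k)) //.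
  by rewrite mulrDl lerD // ler_wpM2l.
by rewrite ler_wpM2r // exprn_ge0 // /m !sum_ord2 !addr_ge0.
Qed.

Definition expm_coef X (i j : 'I_2) (k : nat) : R := (X ^+ k) i j / k`!%:R.

(** Seeing each entry as a scalar power series in t gives access to term-by-term differentiation. *)
Lemma expmE X i j :
  (fun t => expm (t *: X) i j) = (fun t => limn (pseries (expm_coef X i j) t)).
Proof.
apply/funext => t; rewrite mxE /pseries; congr (limn (series _)).
by apply/funext => k; rewrite exprZn mxE [RHS]mulrC mulrA.
Qed.

Lemma pseries_diffs_exp (u : nat -> R) :
  pseries_diffs (fun k => u k / k`!%:R) = fun k => u k.+1 / k`!%:R.
Proof.
apply/funext => k; rewrite /pseries_diffs factS natrM invfM.
by rewrite mulrCA mulrA -mulrA mulVKf.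
Qed.

Lemma is_cvg_pseries_exp (u : nat -> R) (a m : R) :
  (forall k, `|u k| <= a * m ^+ k) -> 0 <= m -> 0 <= a ->
  cvgn (pseries (fun k => u k / k`!%:R) 1).
Proof.
move=> u_le m_ge0 a_ge0; apply: normed_cvg.
apply: (@series_le_cvg _ _ (fun k => a * exp_coeff m k)).
- by move=> k /=.
- by move=> k; rewrite mulr_ge0 // exp_coeff_ge0.
- move=> k /=; rewrite expr1n mulr1 normrM normfV normr_nat /exp_coeff mulrA.
  by rewrite ler_wpM2r.
- exact/is_cvg_seriesZ/is_cvg_series_exp_coeff.
Qed.

Lemma pseries_at0 (u : nat -> R) : limn (pseries u 0) = u 0.
Proof.
(* The empty partial sum is 0, so the partial sums are constant only after a shift by one. *)
apply/cvg_lim => //; rewrite -cvg_shiftS /pseries /series /=.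
rewrite (_ : (fun n => _) = cst (u 0)); first exact: cvg_cst.
apply/funext => n; rewrite big_nat_recl // expr0 mulr1 big1 ?addr0 // => k _.
by rewrite exprS mul0r mulr0.
Qed.

Lemma expm0 X i j : expm (0 *: X) i j = (i == j)%:R.
Proof.
have /(congr1 (@^~ 0)) /= -> := expmE X i j.
by rewrite pseries_at0 /expm_coef expr0 mxE fact0 divr1.
Qed.

Lemma is_derive_expm0 X i j :
  is_derive (0 : R) (1 : R) (fun t => expm (t *: X) i j) (X i j).
Proof.
rewrite expmE; set m := \sum_(i < 2) \sum_(j < 2) `|X i j|.
have m_ge0 : 0 <= m by rewrite /m !sum_ord2 !addr_ge0.
(* The n-th formal derivative has coefficients (X^(n+k))_ij / k!, which the exponential series of
   [m] dominates up to the factor m^n. *)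
have le n k : `|(X ^+ (n + k)) i j| <= m ^+ n * m ^+ k.
  by rewrite -exprD normr_expmx_le.
have cvg n := is_cvg_pseries_exp (le n) m_ge0 (exprn_ge0 n m_ge0).
have d1 : pseries_diffs (expm_coef X i j) = fun k => (X ^+ k.+1) i j / k`!%:R.
  exact: (pseries_diffs_exp (fun k => (X ^+ k) i j)).
have d2 : pseries_diffs (pseries_diffs (expm_coef X i j)) =
    fun k => (X ^+ k.+2) i j / k`!%:R.
  by rewrite d1; exact: (pseries_diffs_exp (fun k => (X ^+ k.+1) i j)).
apply: is_derive_eq.
  (* The point 1 serves as a radius larger than |0| at which the series and its first two formal
     derivatives converge. *)
  apply: (@pseries_snd_diffs _ _ 1).
  - exact: (cvg 0%N).
  - by rewrite d1; exact: (cvg 1%N).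
  - by rewrite d2; exact: (cvg 2%N).
  - by rewrite normr0 normr1.
by rewrite pseries_at0 d1 /= expr1 fact0 divr1.
Qed.
End Exponential.

(** * The infinitesimal action V_X *)

Section Derivatives.
Variable R : realType.
Implicit Types (f g : R -> R) (X J : 'M[R]_2) (p : bpt R).

Lemma is_deriveV_pt f (x df : R) : f x != 0 -> is_derive x (1 : R) f df ->
  is_derive x (1 : R) (fun t => (f t)^-1) (- (f x) ^- 2 * df).
Proof.
by move=> fx [fd <-]; apply: DeriveDef; [exact: derivableV | exact: deriveV].
Qed.

Lemma is_derive1E f (x df : R) : is_derive x (1 : R) f df -> derive1 f x = df.
Proof. by move=> [_ <-]; rewrite derive1E. Qed.

Lemma is_derive_near_neq0 f (x df : R) :
  is_derive x (1 : R) f df -> f x != 0 -> \forall t \near x, f t != 0.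
Proof.
move=> [/derivable1_diffP/differentiable_continuous fc _] fx.
exact: (cvgr_neq0 (f x) fc fx).
Qed.

Section OneParameter.
Variables (P : R -> 'M[R]_2) (X : 'M[R]_2).
Hypotheses (P0 : P 0 = 1%:M)
  (dP : forall i j, is_derive (0 : R) (1 : R) (fun t => P t i j) (X i j)).

Lemma is_derive_det1 : is_derive (0 : R) (1 : R) (fun t => \det (P t)) (\tr X).
Proof.
rewrite (_ : (fun t => _) = fun t => P t 0 0 * P t 1 1 - P t 0 1 * P t 1 0); last first.
  by apply/funext => t; rewrite det_mx2.
apply: is_derive_eq.
by rewrite P0 !mxE /GRing.scale /= mxtrace2E; ring.
Qed.

Lemma is_derive_invmx1 i j :
  is_derive (0 : R) (1 : R) (fun t => invmx (P t) i j) (- X i j).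
Proof.
have dd := is_derive_det1.
have d0 : \det (P 0) != 0 by rewrite P0 det1 oner_neq0.
have dV := is_deriveV_pt d0 dd.
have nd := is_derive_near_neq0 dd d0.
(* [invmx] is adjugate over determinant only for invertible matrices, so each entry is identified
   with its formula only near 0. *)
have near_entry (g : R -> R) dg k l :
    (forall t, \det (P t) != 0 -> g t = invmx (P t) k l) ->
    is_derive (0 : R) (1 : R) g dg -> dg = - X k l ->
    is_derive (0 : R) (1 : R) (fun t => invmx (P t) k l) (- X k l).
  move=> gE gd <-; apply: near_eq_is_derive gd.
  by apply: filterS nd => t; exact: gE.
elim/ord2P: i; elim/ord2P: j.
- apply: (near_entry (fun t => P t 1 1 / \det (P t))) => [t /invmx2E[-> _ _ _] //|].
  by rewrite P0 det1 !mxE /GRing.scale /= mxtrace2E expr1n; field.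
- apply: (near_entry (fun t => - P t 0 1 / \det (P t))) => [t /invmx2E[_ -> _ _] //|].
  by rewrite P0 det1 !mxE /GRing.scale /= mxtrace2E expr1n; field.
- apply: (near_entry (fun t => - P t 1 0 / \det (P t))) => [t /invmx2E[_ _ -> _] //|].
  by rewrite P0 det1 !mxE /GRing.scale /= mxtrace2E expr1n; field.
- apply: (near_entry (fun t => P t 0 0 / \det (P t))) => [t /invmx2E[_ _ _ ->] //|].
  by rewrite P0 det1 !mxE /GRing.scale /= mxtrace2E expr1n; field.
Qed.
End OneParameter.

Lemma expm0mx X : expm (0 *: X) = 1%:M.
Proof. by apply/matrixP => i j; rewrite expm0 !mxE. Qed.

Lemma act1 p : isCpx p.1 -> act 1%:M p = p.
Proof.
move=> cJ; have eA : (act 1%:M p).1 = p.1 by rewrite /= invmx1 mul1mx mulmx1.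
rewrite [LHS]surjective_pairing [RHS]surjective_pairing eA; congr pair.
apply/funext => i; apply/funext => j; apply/funext => k.
by rewrite act_tri // det1 mul1r invmx1 !mul1mx tri_app_sb.
Qed.

(* Derivative at t = 0 of the pull-back of [C] by exp(-tX). *)
Definition tri_Lie X (C : tri R) : tri R := fun i j k =>
  - \sum_(l < 2) (X l i * C l j k + X l j * C i l k + X l k * C i j l).

(** Product rule at exp(0) = 1. The determinant factor of [act_tri] contributes tr X times C, which
    vanishes. *)
Lemma VXE X p : \tr X = 0 -> isCpx p.1 ->
  VX X p = (X *m p.1 - p.1 *m X, raise p.1 (tri_Lie X p.2)).
Proof.
move=> trX cJ; pose P t := expm (t *: X).
have P0 : P 0 = 1%:M by exact: expm0mx.
have dP i j : is_derive (0 : R) (1 : R) (fun t => P t i j) (X i j).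
  exact: is_derive_expm0.
have Q0 : invmx (P 0) = 1%:M by rewrite P0 invmx1.
have dQ := is_derive_invmx1 P0 dP; have dD := is_derive_det1 P0 dP.
rewrite /VX /tangent -/(P 0) P0 act1 //; congr pair.
  apply/matrixP => i j; rewrite mxE; apply: is_derive1E.
  (* Written out as a polynomial in entries, the function is differentiated by instance search from
     the derivatives in the context. *)
  rewrite (_ : (fun t => _) = fun t =>
      (P t i 0 * p.1 0 0 + P t i 1 * p.1 1 0) * invmx (P t) 0 j +
      (P t i 0 * p.1 0 1 + P t i 1 * p.1 1 1) * invmx (P t) 1 j); last first.
    by apply/funext => t; rewrite /= mulmx2E !mulmx2E.
  have d0 := dQ 0 j; have d1 := dQ 1 j; have d2 := dP i 0; have d3 := dP i 1.
  apply: is_derive_eq.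
  rewrite Q0 P0 !mxE !sum_ord2 /GRing.scale /=.
  by elim/ord2P: i {d2 d3}; elim/ord2P: j {d0 d1} => /=; ring.
congr raise; apply/funext => i; apply/funext => j; apply/funext => k.
apply: is_derive1E.
rewrite (_ : (fun t => _) = fun t => \det (P t) *
    (invmx (P t) 0 i *
       (invmx (P t) 0 j * (invmx (P t) 0 k * p.2 0 0 0 + invmx (P t) 1 k * p.2 0 0 1)
      + invmx (P t) 1 j * (invmx (P t) 0 k * p.2 0 1 0 + invmx (P t) 1 k * p.2 0 1 1))
    + invmx (P t) 1 i *
       (invmx (P t) 0 j * (invmx (P t) 0 k * p.2 1 0 0 + invmx (P t) 1 k * p.2 1 0 1)
      + invmx (P t) 1 j * (invmx (P t) 0 k * p.2 1 1 0 + invmx (P t) 1 k * p.2 1 1 1))));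
    last first.
  apply/funext => t; rewrite act_tri // tri_app_mul.
  by rewrite !sum_ord2 !mulmx_sb.
have d0 := dQ 0 i; have d1 := dQ 1 i; have d2 := dQ 0 j; have d3 := dQ 1 j.
have d4 := dQ 0 k; have d5 := dQ 1 k.
apply: is_derive_eq.
rewrite Q0 P0 det1 trX !mxE /GRing.scale /=.
rewrite /tri_Lie !sum_ord2.
by elim/ord2P: i {d0 d1}; elim/ord2P: j {d2 d3}; elim/ord2P: k {d4 d5} => /=; ring.
Qed.

End Derivatives.

(** * The two algebraic identities behind the Hamiltonian equation *)

Section MomentMap.
Variable R : realType.
Implicit Types (f : R -> R) (X J Jd : 'M[R]_2) (C Cd : tri R) (p : bpt R).

(* The relations obtained by differentiating those of [inB0_coord] and
   [inB0_sym] along a curve through [p] with velocity [u]. *)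
Definition linearized p (u : 'M[R]_2 * tri R) : Prop :=
  [/\ u.1 1 1 = - u.1 0 0,
      u.1 0 1 * p.1 1 0 + p.1 0 1 * u.1 1 0 = - (2 * p.1 0 0 * u.1 0 0),
      [/\ u.2 0 1 0 = u.2 0 0 1, u.2 1 0 0 = u.2 0 0 1, u.2 1 0 1 = u.2 0 1 1 &
          u.2 1 1 0 = u.2 0 1 1],
      u.1 1 0 * p.2 0 1 1 + p.1 1 0 * u.2 0 1 1 =
        u.1 0 1 * p.2 0 0 0 + p.1 0 1 * u.2 0 0 0
        - 2 * (u.1 0 0 * p.2 0 0 1 + p.1 0 0 * u.2 0 0 1) &
      u.1 1 0 * p.2 1 1 1 + p.1 1 0 * u.2 1 1 1 =
        u.1 0 1 * p.2 0 0 1 + p.1 0 1 * u.2 0 0 1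
        - 2 * (u.1 0 0 * p.2 0 1 1 + p.1 0 0 * u.2 0 1 1)].

Lemma linearized_coord p u : inB0 p -> linearized p u ->
  [/\ u.1 0 1 = - (2 * p.1 0 0 * u.1 0 0 + p.1 0 1 * u.1 1 0) / p.1 1 0,
      u.2 0 1 1 = (u.1 0 1 * p.2 0 0 0 + p.1 0 1 * u.2 0 0 0
        - 2 * (u.1 0 0 * p.2 0 0 1 + p.1 0 0 * u.2 0 0 1)
        - u.1 1 0 * p.2 0 1 1) / p.1 1 0 &
      u.2 1 1 1 = (u.1 0 1 * p.2 0 0 1 + p.1 0 1 * u.2 0 0 1
        - 2 * (u.1 0 0 * p.2 0 1 1 + p.1 0 0 * u.2 0 1 1)
        - u.1 1 0 * p.2 1 1 1) / p.1 1 0].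
Proof.
move=> pB [_ e1 _ e2 e3]; have [_ _ /lt0r_neq0 cN0] := isCpx_coord pB.1.
split; apply: (mulIf cN0); rewrite divfK //.
- by rewrite opprD -e1 addrK.
- by rewrite -e2 addrAC subrr add0r mulrC.
- by rewrite -e3 addrAC subrr add0r mulrC.
Qed.

(** Each half of the commutator contributes tr(J' X) / 2, because J^2 = -1 and J anticommutes with
    its velocity J'; the proof checks this in coordinates. *)
Lemma ipJ_VX p X u : \tr X = 0 -> inB0 p -> linearized p u ->
  ipJ (X *m p.1 - p.1 *m X) (- (p.1 *m u.1)) = \tr (u.1 *m X).
Proof.
move=> trX pB uT; have [tru _ _ _ _] := uT.
have [db _ _] := linearized_coord pB uT; have [bE _ _] := inB0_coord pB.
have [trJ _ /lt0r_neq0 cN0] := isCpx_coord pB.1.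
have X11 : X 1 1 = - X 0 0 by apply/eqP; rewrite -addr_eq0 addrC -mxtrace2E trX.
rewrite /ipJ !mxtrace2E !mulmx2E !mxE !sum_ord2 X11 tru trJ db bE.
by field.
Qed.

(* The differential at [p] of the expression in [norm0sqE]. *)
Definition dnorm0sq p (u : 'M[R]_2 * tri R) : R :=
  let s := p.1 0 0 * p.2 0 0 0 + p.1 1 0 * p.2 0 0 1 in
  let ds := u.1 0 0 * p.2 0 0 0 + p.1 0 0 * u.2 0 0 0
          + (u.1 1 0 * p.2 0 0 1 + p.1 1 0 * u.2 0 0 1) in
  2 * (p.2 0 0 0 * u.2 0 0 0 + s * ds) / p.1 1 0 ^+ 3
  - 3 * (p.2 0 0 0 ^+ 2 + s ^+ 2) / p.1 1 0 ^+ 4 * u.1 1 0.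

(** Trace-free and scalar parts are orthogonal for the trace, with pairings tr(B B') - tr B tr B' /
    2 and tr B tr B' / 2. The weights 1/3 and -1/6 then merge, with 3/4 = 1/2 + 1/4. *)
Lemma A0_Atr_combination (B B' : 'M[R]_2) :
  \tr ((B - (\tr B / 2) *: 1%:M) *m (B' - (\tr B' / 2) *: 1%:M)) / 3
  - \tr (((\tr B / 2) *: (1%:M : 'M[R]_2)) *m ((\tr B' / 2) *: 1%:M)) / 6 =
  (\tr (B *m B') - 3 / 4 * (\tr B * \tr B')) / 3.
Proof.
by rewrite !(mxtrace2E, mulmx2E) !mxE /= ?mulr1n ?mulr0n; field.
Qed.

(** Regroups by entries of the inverse Gram matrix, so that [A0_Atr_combination] applies to each
    pair of form components. *)
Lemma split_combination (a b c s00 s01 s10 s11 t00 t01 t10 t11 : R) :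
  (a * s00 + b * (s01 + s10) + c * s11) / 3
  - (a * t00 + b * (t01 + t10) + c * t11) / 6 =
  a * (s00 / 3 - t00 / 6) + b * ((s01 / 3 - t01 / 6) + (s10 / 3 - t10 / 6))
  + c * (s11 / 3 - t11 / 6).
Proof. by field. Qed.

Lemma ipA_combination J (V W : form1 R) : isCpx J ->
  ipA J (A0 V) (A0 W) / 3 - ipA J (Atr V) (Atr W) / 6 =
  - J 0 1 * ((\tr (V 0 *m W 0) - 3 / 4 * (\tr (V 0) * \tr (W 0))) / 3)
  + J 0 0 * ((\tr (V 0 *m W 1) - 3 / 4 * (\tr (V 0) * \tr (W 1))) / 3
           + (\tr (V 1 *m W 0) - 3 / 4 * (\tr (V 1) * \tr (W 0))) / 3)
  + J 1 0 * ((\tr (V 1 *m W 1) - 3 / 4 * (\tr (V 1) * \tr (W 1))) / 3).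
Proof.
by move=> cJ; rewrite (ipAE _ _ cJ) (ipAE _ _ cJ) split_combination -!A0_Atr_combination.
Qed.

(** [V] is the form part of V_X and [W] that of [Iop] applied to the tangent vector, so this is the
    coefficient of f' in omega. *)
Lemma ipA_VX p X u : \tr X = 0 -> inB0 p -> linearized p u ->
  let A := raise p.1 p.2 in
  let V := raise p.1 (tri_Lie X p.2) in
  let W : form1 R := fun i => - (raise p.1 u.2 i *m p.1) - A i *m u.1 in
  ipA p.1 (A0 V) (A0 W) / 3 - ipA p.1 (Atr V) (Atr W) / 6 =
  - (dnorm0sq p u * \tr (p.1 *m X)).
Proof.
move=> trX pB uT; have cJ := pB.1; have [tru _ [u1 u2 u3 u4] _ _] := uT.
have [db d0 d1] := linearized_coord pB uT; have [bE e0 e1] := inB0_coord pB.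
have [s1 s2 s3 s4] := inB0_sym pB.
have [trJ _ /lt0r_neq0 cN0] := isCpx_coord cJ.
have X11 : X 1 1 = - X 0 0 by apply/eqP; rewrite -addr_eq0 addrC -mxtrace2E trX.
move=> A V W.
have entryV i k j : V i k j =
    if k == 0 then - p.1 0 1 * tri_Lie X p.2 i j 0 + p.1 0 0 * tri_Lie X p.2 i j 1
    else p.1 0 0 * tri_Lie X p.2 i j 0 + p.1 1 0 * tri_Lie X p.2 i j 1 by exact: raiseE.
have entryW i k j : W i k j =
    - (raise p.1 u.2 i k 0 * p.1 0 j + raise p.1 u.2 i k 1 * p.1 1 j)
    - (A i k 0 * u.1 0 j + A i k 1 * u.1 1 j).
  by rewrite /W mxE mxE mulmx2E [X in _ + X]mxE mulmx2E.
rewrite ipA_combination //.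
rewrite !mxtrace2E !mulmx2E !entryV !entryW !raiseE //=.
rewrite /tri_Lie /dnorm0sq !sum_ord2 /= X11 tru trJ.
rewrite !(s1, s2, s3, s4) !(u1, u2, u3, u4).
(* Each rule mentions only quantities eliminated after it: first the dependent velocities, then the
   dependent entries. *)
rewrite d1 d0 db e1 e0 bE.
by field.
Qed.

End MomentMap.

(** * Differentiation along a curve in the deformation space *)

Section Curve.
Variables (R : realType) (gamma : R -> bpt R).
Hypotheses (gB : forall t, inB0 (gamma t)) (gd : curve_derivable gamma).

Let dJ : 'M[R]_2 := \matrix_(i, j) derive1 (fun t => (gamma t).1 i j) 0.
Let dC : tri R := fun i j k => derive1 (fun t => (gamma t).2 i j k) 0.

Lemma is_derive_curve1 i j :
  is_derive (0 : R) (1 : R) (fun t => (gamma t).1 i j) (dJ i j).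
Proof. by rewrite mxE derive1E; apply: derivableP; apply: gd.1. Qed.

Lemma is_derive_curve2 i j k :
  is_derive (0 : R) (1 : R) (fun t => (gamma t).2 i j k) (dC i j k).
Proof. by rewrite /dC derive1E; apply: derivableP; apply: gd.2. Qed.

(** Each defining relation equates two functions of t along the whole curve, so their derivatives at
    0 agree. The relations are taken in their division-free form, where the product rule
    suffices. *)
Lemma linearized_curve : linearized (gamma 0) (dJ, dC).
Proof.
have d1 := is_derive_curve1; have d2 := is_derive_curve2.
have eq_derive (g h : R -> R) dg dh : is_derive (0 : R) (1 : R) g dg ->
    is_derive (0 : R) (1 : R) h dh -> g =1 h -> dg = dh.
  by move=> [_ <-] [_ <-] /funext ->.
have coord t := isCpx_coord (gB t).1.
have sym t := inB0_sym (gB t).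
have tf i t := inB0_trace_free i (gB t).
split=> /=.
- apply: (eq_derive (fun t => (gamma t).1 1 1) (fun t => - (gamma t).1 0 0)).
  by move=> t; case: (coord t).
- apply: (eq_derive (fun t => (gamma t).1 0 1 * (gamma t).1 1 0)
    (fun t => - 1 - (gamma t).1 0 0 * (gamma t).1 0 0)) => [||t].
  + by apply: is_derive_eq; rewrite /GRing.scale /=; ring.
  + by apply: is_derive_eq; rewrite /GRing.scale /=; ring.
  by case: (coord t).
- split; rewrite /dC; congr derive1; apply/funext => t; by case: (sym t).
- apply: (eq_derive (fun t => (gamma t).1 1 0 * (gamma t).2 0 1 1)
    (fun t => (gamma t).1 0 1 * (gamma t).2 0 0 0
      - 2 * ((gamma t).1 0 0 * (gamma t).2 0 0 1))) => [||t].
  + by apply: is_derive_eq; rewrite /GRing.scale /=; ring.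
  + by apply: is_derive_eq; rewrite /GRing.scale /=; ring.
  by rewrite tf mulrA.
- apply: (eq_derive (fun t => (gamma t).1 1 0 * (gamma t).2 1 1 1)
    (fun t => (gamma t).1 0 1 * (gamma t).2 0 0 1
      - 2 * ((gamma t).1 0 0 * (gamma t).2 0 1 1))) => [||t].
  + by apply: is_derive_eq; rewrite /GRing.scale /=; ring.
  + by apply: is_derive_eq; rewrite /GRing.scale /=; ring.
  by have [_ s2 s3 _] := sym t; rewrite tf s2 s3 mulrA.
Qed.

Lemma is_derive_norm0sq : is_derive (0 : R) (1 : R)
  (fun t => norm0sq (gamma t).1 (raise (gamma t).1 (gamma t).2))
  (dnorm0sq (gamma 0) (dJ, dC)).
Proof.
have d1 := is_derive_curve1; have d2 := is_derive_curve2.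
have [_ _ /lt0r_neq0 cN0] := isCpx_coord (gB 0).1.
under [fun t => _]funext => t do rewrite norm0sqE //.
have dc := d1 1 0.
have c3 : is_derive (0 : R) (1 : R) (fun t => (gamma t).1 1 0 ^+ 3)
    (3 * (gamma 0).1 1 0 ^+ 2 * dJ 1 0).
  rewrite (_ : (fun t => _) =
    fun t => (gamma t).1 1 0 * ((gamma t).1 1 0 * (gamma t).1 1 0)) //.
  by apply: is_derive_eq; rewrite /GRing.scale /=; ring.
have V := @is_deriveV_pt R (fun t => (gamma t).1 1 0 ^+ 3) 0 _ (expf_neq0 3 cN0) c3.
have N : is_derive (0 : R) (1 : R) (fun t => (gamma t).2 0 0 0 ^+ 2 +
    ((gamma t).1 0 0 * (gamma t).2 0 0 0 + (gamma t).1 1 0 * (gamma t).2 0 0 1) ^+ 2)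
   (2 * ((gamma 0).2 0 0 0 * dC 0 0 0 +
    ((gamma 0).1 0 0 * (gamma 0).2 0 0 0 + (gamma 0).1 1 0 * (gamma 0).2 0 0 1) *
    (dJ 0 0 * (gamma 0).2 0 0 0 + (gamma 0).1 0 0 * dC 0 0 0 +
     (dJ 1 0 * (gamma 0).2 0 0 1 + (gamma 0).1 1 0 * dC 0 0 1)))).
  under [fun t => _]funext => t do rewrite !expr2.
  by apply: is_derive_eq; rewrite /GRing.scale /=; ring.
apply: (is_derive_eq (is_deriveM N V)).
by rewrite /dnorm0sq /GRing.scale /=; field.
Qed.

Lemma is_derive_mu f X : derivable f (norm0sq (gamma 0).1 (raise (gamma 0).1 (gamma 0).2)) 1 ->
  \tr X = 0 ->
  is_derive (0 : R) (1 : R) (fun t => mu f (gamma t) X)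
    (omega f (gamma 0) (VX X (gamma 0)) (tangent gamma)).
Proof.
move=> df trX; set n0 := norm0sq _ _ in df.
have gB0 := gB 0.
have dn := is_derive_norm0sq; have lin := linearized_curve.
have d1 := is_derive_curve1.
have dtr : is_derive (0 : R) (1 : R) (fun t => \tr ((gamma t).1 *m X)) (\tr (dJ *m X)).
  under [fun t => _]funext => t do rewrite mxtrace2E !mulmx2E.
  apply: is_derive_eq.
  by rewrite mxtrace2E !mulmx2E /GRing.scale /=; ring.
have df1 : is_derive n0 (1 : R) f (derive1 f n0).
  by rewrite derive1E; apply: derivableP.
have dfn := @is_derive1_comp R f
  (fun t => norm0sq (gamma t).1 (raise (gamma t).1 (gamma t).2)) 0 _ _ df1 dn.
rewrite VXE //; last by case: gB0.
rewrite /omega /gmet /Iop /tangent /= -/dJ -/dC.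
have E1 := ipJ_VX trX gB0 lin; have E2 := ipA_VX trX gB0 lin.
rewrite /= in E1 E2; rewrite -/n0 E1 -addrA.
(* Groups the two f'-terms of [gmet] into the combination computed by [ipA_VX]. *)
have factor (x y z : R) : x / 3 * y - x / 6 * z = x * (y / 3 - z / 6) by field.
rewrite factor E2 /mu.
have {}dfn : is_derive (0 : R) (1 : R) (fun t => 1 - f (norm0sq (gamma t).1
    (raise (gamma t).1 (gamma t).2))) (- (derive1 f n0 * dnorm0sq (gamma 0) (dJ, dC))).
  by apply: is_derive_eq; rewrite add0r mul1r.
apply: is_derive_eq; rewrite -/n0 /GRing.scale /=; ring.
Qed.
End Curve.

(** * Equivariance and the Hamiltonian equation, the latter tested on velocities of derivable
    curves *)

Theorem theoremC (R : realType) (f : R -> R)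
  (f_smooth : smooth f)
  (f_nonpos : forall t : R, 0 <= t -> f t <= 0)
  (f_decr : forall t : R, 0 <= t -> derive1 f t < 0)
  (f_lim : f x @[x --> +oo] --> -oo) :
  (forall (P : 'M[R]_2) (p : bpt R) (X : 'M[R]_2),
      \det P = 1 -> inB0 p -> \tr X = 0 ->
      mu f (act P p) X = mu f p (invmx P *m X *m P)) /\
  (forall (X : 'M[R]_2) (gamma : R -> bpt R),
      \tr X = 0 -> (forall t, inB0 (gamma t)) -> curve_derivable gamma ->
      is_derive (0 : R) (1 : R) (fun t => mu f (gamma t) X)
        (omega f (gamma 0) (VX X (gamma 0)) (tangent gamma))).
Proof.
split=> [P p X detP pB _|X gamma trX gB gd]; first exact: mu_act pB.1.
by apply: is_derive_mu => //; apply: (f_smooth 0%N).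
Qed.
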